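(* Let $\mathbf{2}$ denote the two-element Boolean algebra and $\mathbf{3}$ the three-element chain $0<a<1$. (1) For every set $I$, $\mathbf{3}^{I}$ and $(\mathbf{2}^{I})^{[2]}$ are isomorphic as lattices. (2) For every set $I$, $\mathbf{3}^{I}$ and $(\mathbf{2}^{I})^{[2]}$ are isomorphic as Stone algebras (with $\mathbf{3}=\mathbf{3}_{\sim}$ and negation $\sim$), and they are isomorphic as dual Stone algebras (with $\mathbf{3}=\mathbf{3}_{\neg}$ and negation $\neg$). (3) For every Stone algebra $\mathcal{S}$ there exists a set $I$ such that $\mathcal{S}$ can be embedded into the Stone algebra $(\mathbf{2}^{I})^{[2]}$. (4) For every dual Stone algebra $\mathcal{DS}$ there exists a set $I$ such that $\mathcal{DS}$ can be embedded into the dual Stone algebra $(\mathbf{2}^{I})^{[2]}$.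
   Context: A Stone algebra is an algebra $(S,\vee,\wedge,\sim,0,1)$ such that $(S,\vee,\wedge,0,1)$ is a bounded distributive lattice, for every $a\in S$ the element $\sim a=\max\{c\in S: a\wedge c=0\}$ exists, and $\sim a\vee\sim\sim a=1$ for all $a$. A dual Stone algebra is an algebra $(D,\vee,\wedge,\neg,0,1)$ such that $(D,\vee,\wedge,0,1)$ is a bounded distributive lattice, for every $a\in D$ the element $\neg a=\min\{c\in D: a\vee c=1\}$ exists, and $\neg a\wedge\neg\neg a=0$ for all $a$. The one-element algebra is allowed. For a Boolean algebra $B$ with complement $^{c}$, $B^{[2]}:=\{(a,b)\in B^2: a\le b\}$ with componentwise $\vee,\wedge$, bottom $(0,0)$ and top $(1,1)$. It is a Stone algebra with $\sim(a,b):=(b^{c},b^{c})$ and a dual Stone algebra with $\neg(a,b):=(a^{c},a^{c})$. $\mathbf{3}_{\sim}$ is the Stone algebra on the chain $0<a<1$ with $\sim 0=1$, $\sim a=\sim 1=0$. $\mathbf{3}_{\neg}$ is the dual Stone algebra on the chain $0<a<1$ with $\neg 0=\neg a=1$, $\neg 1=0$. The powers $\mathbf{3}^{I}$ and $\mathbf{2}^{I}$ carry pointwise operations. Embeddings and isomorphisms preserve all operations of the indicated signature, including $0$ and $1$. *)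

(* Defs.v *)
From HB Require Import structures.
From mathcomp Require Import all_boot all_order.
From mathcomp Require Import boolp.

Set Implicit Arguments.
Unset Strict Implicit.
Unset Printing Implicit Defensive.

Import Order.Theory.
Local Open Scope order_scope.

(* [sim a] is the maximum of {c | a `&` c = 0}. *)
HB.mixin Record TBDistrLattice_isStone d T of Order.TBDistrLattice d T := {
  sim : T -> T;
  meetx_sim : forall a : T, a `&` sim a = \bot;
  sim_max : forall a c : T, a `&` c = \bot -> c <= sim a;
  joinsim_sim2 : forall a : T, sim a `|` sim (sim a) = \top;
}.

#[short(type="stoneType")]
HB.structure Definition Stone d :=
  { T of Order.TBDistrLattice d T & TBDistrLattice_isStone d T }.

(* [dneg a] is the minimum of {c | a `|` c = 1}. *)
HB.mixin Record TBDistrLattice_isDualStone d T of Order.TBDistrLattice d T := {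
  dneg : T -> T;
  joinx_dneg : forall a : T, a `|` dneg a = \top;
  dneg_min : forall a c : T, a `|` c = \top -> dneg a <= c;
  meetdneg_dneg2 : forall a : T, dneg a `&` dneg (dneg a) = \bot;
}.

#[short(type="dualStoneType")]
HB.structure Definition DualStone d :=
  { T of Order.TBDistrLattice d T & TBDistrLattice_isDualStone d T }.

(* The library's {tblmorphism S -> T} only asserts preservation of \bot and \top,
   not of meets and joins, hence the explicit conjunction. *)
Definition tblattice_morphism d (S : tbLatticeType d) d' (T : tbLatticeType d')
    (f : S -> T) : Prop :=
  [/\ {morph f : x y / x `&` y}, {morph f : x y / x `|` y},
      f \bot = \bot & f \top = \top].

Definition stone_morphism d (S : stoneType d) d' (T : stoneType d')
    (f : S -> T) : Prop :=
  tblattice_morphism f /\ {morph f : x / sim x}.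

Definition dual_stone_morphism d (S : dualStoneType d) d'
    (T : dualStoneType d') (f : S -> T) : Prop :=
  tblattice_morphism f /\ {morph f : x / dneg x}.

Definition lattice_isomorphic d (S : tbLatticeType d) d'
    (T : tbLatticeType d') : Prop :=
  exists f : S -> T, tblattice_morphism f /\ bijective f.

Definition stone_isomorphic d (S : stoneType d) d' (T : stoneType d') : Prop :=
  exists f : S -> T, stone_morphism f /\ bijective f.

Definition dual_stone_isomorphic d (S : dualStoneType d) d'
    (T : dualStoneType d') : Prop :=
  exists f : S -> T, dual_stone_morphism f /\ bijective f.

Definition stone_embeddable d (S : stoneType d) d' (T : stoneType d') : Prop :=
  exists f : S -> T, stone_morphism f /\ injective f.

Definition dual_stone_embeddable d (S : dualStoneType d) d'
    (T : dualStoneType d') : Prop :=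
  exists f : S -> T, dual_stone_morphism f /\ injective f.

(* The pointwise lattice structure on [I -> T] itself comes from boolp. *)
Section FunDistr.
Variables (I : Type) (d : Order.disp_t) (T : distrLatticeType d).

Fact fun_meetUl : @left_distributive (I -> T) _ Order.meet Order.join.
Proof. by move=> f g h; apply/funext => x; exact: meetUl. Qed.

HB.instance Definition _ :=
  Order.Lattice_Meet_isDistrLattice.Build _ (I -> T) fun_meetUl.
End FunDistr.

Section FunTB.
Variables (I : Type) (d : Order.disp_t) (T : tbDistrLatticeType d).

Fact fun_le0 (f : I -> T) : (fun=> \bot : T) <= f.
Proof. by apply/lefP => x; exact: le0x. Qed.

Fact fun_le1 (f : I -> T) : f <= (fun=> \top : T).
Proof. by apply/lefP => x; exact: lex1. Qed.

HB.instance Definition _ := Order.hasBottom.Build _ (I -> T) fun_le0.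
HB.instance Definition _ := Order.hasTop.Build _ (I -> T) fun_le1.
End FunTB.

Section FunCompl.
Variables (I : Type) (d : Order.disp_t) (T : ctbDistrLatticeType d).

Fact fun_joinxC (f : I -> T) : f `|` (fun i => ~` f i) = \top.
Proof. by apply/funext => x; exact: joinxC. Qed.

Fact fun_meetxC (f : I -> T) : f `&` (fun i => ~` f i) = \bot.
Proof. by apply/funext => x; exact: meetxC. Qed.

HB.instance Definition _ :=
  Order.TBDistrLattice_hasComplement.Build _ (I -> T) fun_joinxC fun_meetxC.
End FunCompl.

Section FunStone.
Variables (I : Type) (d : Order.disp_t) (T : stoneType d).
Implicit Types f g : I -> T.

Let fsim f : I -> T := fun i => sim (f i).

Fact fun_meetx_sim f : f `&` fsim f = \bot.
Proof. by apply/funext => i; exact: meetx_sim. Qed.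

Fact fun_sim_max f g : f `&` g = \bot -> g <= fsim f.
Proof.
by move=> fg; apply/lefP => i; apply: sim_max; exact: (congr1 (@^~ i) fg).
Qed.

Fact fun_joinsim_sim2 f : fsim f `|` fsim (fsim f) = \top.
Proof. by apply/funext => i; exact: joinsim_sim2. Qed.

HB.instance Definition _ := TBDistrLattice_isStone.Build _ (I -> T)
  fun_meetx_sim fun_sim_max fun_joinsim_sim2.
End FunStone.

Section FunDualStone.
Variables (I : Type) (d : Order.disp_t) (T : dualStoneType d).
Implicit Types f g : I -> T.

Let fdneg f : I -> T := fun i => dneg (f i).

Fact fun_joinx_dneg f : f `|` fdneg f = \top.
Proof. by apply/funext => i; exact: joinx_dneg. Qed.

Fact fun_dneg_min f g : f `|` g = \top -> fdneg f <= g.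
Proof.
by move=> fg; apply/lefP => i; apply: dneg_min; exact: (congr1 (@^~ i) fg).
Qed.

Fact fun_meetdneg_dneg2 f : fdneg f `&` fdneg (fdneg f) = \bot.
Proof. by apply/funext => i; exact: meetdneg_dneg2. Qed.

HB.instance Definition _ := TBDistrLattice_isDualStone.Build _ (I -> T)
  fun_joinx_dneg fun_dneg_min fun_meetdneg_dneg2.
End FunDualStone.

Section Square.
Variables (d : Order.disp_t) (B : ctbDistrLatticeType d).

Definition square_pred : {pred B *p B} := fun p => p.1 <= p.2.

Record square := Square { square_val : B *p B; _ : square_val \in square_pred }.

HB.instance Definition _ := [isSub for square_val].
HB.instance Definition _ := [Choice of square by <:].

Fact square_meet : {in square_pred &, forall p q, p `&` q \in square_pred}.
Proof. by move=> p q pP qP; exact: leI2. Qed.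

Fact square_join : {in square_pred &, forall p q, p `|` q \in square_pred}.
Proof. by move=> p q pP qP; exact: leU2. Qed.

Fact square_bot : \bot \in square_pred. Proof. exact: lexx. Qed.
Fact square_top : \top \in square_pred. Proof. exact: lexx. Qed.

HB.instance Definition _ :=
  Order.SubChoice_isTBSubLattice.Build _ _ square_pred d square
    square_meet square_join square_bot square_top.

Fact square_valI (x y : square) :
  square_val (x `&` y) = ((square_val x).1 `&` (square_val y).1, (square_val x).2 `&` (square_val y).2).
Proof. by []. Qed.

Fact square_valU (x y : square) :
  square_val (x `|` y) = ((square_val x).1 `|` (square_val y).1, (square_val x).2 `|` (square_val y).2).
Proof. by []. Qed.

Fact square_val0 : square_val \bot = (\bot, \bot). Proof. by []. Qed.
Fact square_val1 : square_val \top = (\top, \top). Proof. by []. Qed.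

Fact square_leE (x y : square) : (x <= y) = ((square_val x).1 <= (square_val y).1) && ((square_val x).2 <= (square_val y).2).
Proof. by []. Qed.

Fact square_meetUl : @left_distributive square _ Order.meet Order.join.
Proof.
by move=> x y z; apply: val_inj; congr pair; exact: meetUl.
Qed.

HB.instance Definition _ :=
  Order.Lattice_Meet_isDistrLattice.Build d square square_meetUl.

Fact square_le12 (x : square) : (square_val x).1 <= (square_val x).2. Proof. exact: (valP x). Qed.

Definition square_diag (b : B) : square := @Square (b, b) (lexx b).
Definition square_sim (x : square) : square := square_diag (~` (square_val x).2).
Definition square_dneg (x : square) : square := square_diag (~` (square_val x).1).

Fact square_meetx_sim x : x `&` square_sim x = \bot.
Proof.
apply: val_inj; congr pair => /=; last exact: meetxC.
by apply/eqP; rewrite -lex0 -(meetxC (square_val x).2) leI2 ?square_le12.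
Qed.

Fact square_sim_max x y : x `&` y = \bot -> y <= square_sim x.
Proof.
move/(congr1 (fun z : square => (square_val z).2)) => /= xy.
have y2 : (square_val y).2 <= ~` (square_val x).2 by rewrite -disj_leC meetC xy.
by rewrite square_leE /= y2 (le_trans (square_le12 y)).
Qed.

Fact square_joinsim_sim2 x : square_sim x `|` square_sim (square_sim x) = \top.
Proof. by apply: val_inj; congr pair; exact: joinxC. Qed.

HB.instance Definition _ := TBDistrLattice_isStone.Build d square
  square_meetx_sim square_sim_max square_joinsim_sim2.

Fact square_joinx_dneg x : x `|` square_dneg x = \top.
Proof.
apply: val_inj; congr pair => /=; first exact: joinxC.
by apply/eqP; rewrite -le1x -(joinxC (square_val x).1) leU2 ?square_le12.
Qed.

Fact square_dneg_min x y : x `|` y = \top -> square_dneg x <= y.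
Proof.
move/(congr1 (fun z : square => (square_val z).1)) => /= xy.
have y1 : ~` (square_val x).1 <= (square_val y).1.
  by rewrite -[~` (square_val x).1]meetx1 -[\top]xy meetUr meetCx join0x leIr.
by rewrite square_leE /= y1 (le_trans y1 (square_le12 y)).
Qed.

Fact square_meetdneg_dneg2 x :
  square_dneg x `&` square_dneg (square_dneg x) = \bot.
Proof. by apply: val_inj; congr pair; exact: meetxC. Qed.

HB.instance Definition _ := TBDistrLattice_isDualStone.Build d square
  square_joinx_dneg square_dneg_min square_meetdneg_dneg2.
End Square.

Notation "B ^[2]" := (square B) (at level 2, format "B ^[2]") : type_scope.

(* An alias, so that the negations below are not attached to 'I_3 itself; the
   library has no joint instance for the order and the bounds of 'I_n.+1. *)
Definition three : Type := 'I_3.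
HB.instance Definition _ := Order.Total.copy three 'I_3.

Fact three_le0 (x : three) : (ord0 : three) <= x. Proof. exact: leq0n. Qed.
Fact three_le1 (x : three) : x <= (ord_max : three). Proof. exact: leq_ord. Qed.

HB.instance Definition _ := Order.hasBottom.Build _ three three_le0.
HB.instance Definition _ := Order.hasTop.Build _ three three_le1.

Definition three_sim (x : three) : three := if x == \bot then \top else \bot.
Definition three_dneg (x : three) : three := if x == \top then \bot else \top.

Fact three_meetx_sim x : x `&` three_sim x = \bot.
Proof. by rewrite /three_sim; case: eqP => [->|_]; rewrite ?meet0x ?meetx0. Qed.

Fact three_sim_max x y : x `&` y = \bot -> y <= three_sim x.
Proof.
rewrite /three_sim; case: eqP => [_ _|x0]; first exact: lex1.
by rewrite meetEtotal /Order.min; case: ifP => _ => [/x0|->].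
Qed.

Fact three_joinsim_sim2 x : three_sim x `|` three_sim (three_sim x) = \top.
Proof. by rewrite /three_sim; case: (x == \bot); rewrite ?joinx1 ?join1x ?eqxx ?joinx1. Qed.

HB.instance Definition _ := TBDistrLattice_isStone.Build _ three
  three_meetx_sim three_sim_max three_joinsim_sim2.

Fact three_joinx_dneg x : x `|` three_dneg x = \top.
Proof. by rewrite /three_dneg; case: eqP => [->|_]; rewrite ?join1x ?joinx1. Qed.

Fact three_dneg_min x y : x `|` y = \top -> three_dneg x <= y.
Proof.
rewrite /three_dneg; case: eqP => [_ _|x1]; first exact: le0x.
by rewrite joinEtotal /Order.max; case: ifP => _ => [->|/x1].
Qed.

Fact three_meetdneg_dneg2 x :
  three_dneg x `&` three_dneg (three_dneg x) = \bot.
Proof. by rewrite /three_dneg; case: (x == \top); rewrite ?meet0x ?eqxx ?meetx0. Qed.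

HB.instance Definition _ := TBDistrLattice_isDualStone.Build _ three
  three_joinx_dneg three_dneg_min three_meetdneg_dneg2.

(* Main.v *)
(* In a Stone algebra x |-> ~~x is a bounded lattice endomorphism above the
   identity, and ~x is the complement of ~~x.  Taking for I the prime filters P,
   x |-> (x \in P, ~~x \in P)_P is therefore a Stone morphism into (2^I)^[2],
   injective because prime filters separate points (Zorn).  Dually, a dual Stone
   algebra embeds through the pairs (~~x \in P, x \in P).  The isomorphism from
   3^I is, in each coordinate, 0, a, 1 |-> (0,0), (0,1), (1,1). *)
Require Import Defs.
From mathcomp Require Import all_boot all_order.
From HB Require Import structures.
From mathcomp Require Import boolp classical_sets.

Set Implicit Arguments.
Unset Strict Implicit.
Unset Printing Implicit Defensive.

Import Order.Theory.
Local Open Scope order_scope.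

(** * Separation by prime filters, and maps into pairs *)

Section PrimeFilter.
Variables (d : Order.disp_t) (L : tbDistrLatticeType d).

(* Prime filters, as bounded lattice morphisms to the two-element chain. *)
Record bool_hom := BoolHom {
  bool_hom_val :> L -> bool;
  bool_homP : tblattice_morphism bool_hom_val }.

(** Neither upward closure nor nonemptiness is demanded, so unions of chains, the empty one
    included, are easy to check; maximality supplies the rest. *)
Let separating (x y : L) : set (set L) := fun A =>
  (forall a b, A a -> A b -> A (a `&` b)) /\
  (forall a, A a -> ~ x `&` a <= y).

Lemma maximal_separating (x y : L) : exists2 M : set L,
  separating x y M & forall B : set L, (M `<` B)%classic -> ~ separating x y B.
Proof.
have [|M [PM maxM]] := @Zorn_bigcup L (separating x y); last by exists M.
move=> F FP Ftot; split=> [a b [A FA Aa] [B FB Bb]|a [A FA Aa]]; last first.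
  by have [_] := FP _ FA; apply.
have [AB|BA] := Ftot _ _ FA FB.
- by exists B => //; have [+ _] := FP _ FB; apply=> //; exact: AB.
- by exists A => //; have [+ _] := FP _ FA; apply=> //; exact: BA.
Qed.

(** A maximal [M] is a prime filter, since any [z] outside it has a meet with [x] and some member of
    [M] that lies below [y]. *)
Lemma prime_filter_separation (x y : L) : ~ x <= y ->
  exists2 p : bool_hom, p x & ~~ p y.
Proof.
move=> xy; have [M [MI My] maxM] := maximal_separating x y.
(* Adjoining [\top] covers the case that [M] is empty, which is excluded only by [M1] below. *)
pose G a := a = \top \/ M a.
have GI a b : G a -> G b -> G (a `&` b).
  move=> [->|Ma] [->|Mb]; rewrite ?meet1x ?meetx1; [by left| | |];
    right=> //; exact: MI.
(* Maximality, applied to the filter generated by M, x and z. *)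
have extend z : ~ M z -> exists2 a, G a & x `&` a `&` z <= y.
  move=> Mz; pose B : set L := fun w => exists2 a, G a & x `&` a `&` z <= w.
  have MB : (M `<` B)%classic.
    split=> [w Mw|BM].
      by exists w; [right|rewrite -meetA leIxr// leIl].
    by apply: Mz; apply: BM; exists \top; [left|exact: leIr].
  apply: contrapT => noa; apply: (maxM _ MB); split.
    move=> v w [a Ga av] [b Gb bw]; exists (a `&` b); first exact: GI.
    rewrite lexI (le_trans _ av) ?(le_trans _ bw)//.
      by rewrite leI2// leI2// leIr.
    by rewrite leI2// leI2// leIl.
  move=> w [a Ga aw] wy; apply: noa; exists a => //.
  by apply: le_trans wy; rewrite lexI aw -meetA leIl.
have M1 : M \top.
  apply: contrapT => nM1; have [a Ga] := extend \top nM1; rewrite meetx1.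
  by case: Ga => [->|/My//]; rewrite meetx1.
have GM a : G a -> M a by case=> [->|].
have upM z w : z <= w -> M z -> M w.
  move=> zw Mz; apply: contrapT => /extend[a /GM Ma aw].
  apply: (My _ (MI _ _ Ma Mz)); apply: le_trans aw.
  by rewrite -meetA leI2// leI2.
have primeM z w : M (z `|` w) -> M z \/ M w.
  move=> Mzw; apply: contrapT => /not_orP[/extend[a /GM Ma az] /extend[b /GM Mb bw]].
  (* By distributivity [x] meets [a], [b] and the join of [z] and [w] in an element below [y]. *)
  apply: (My _ (MI _ _ (MI _ _ Ma Mb) Mzw)).
  rewrite meetA meetUr leUx; apply/andP; split.
    by apply: le_trans az; rewrite leI2// leI2// leIl.
  by apply: le_trans bw; rewrite leI2// leI2// leIr.
have hom : tblattice_morphism (fun z => `[< M z >]).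
  split=> [z w|z w||].
  - apply/asboolP/andP => [Mzw|[/asboolP Mz /asboolP Mw]]; last exact: MI.
    by split; apply/asboolP; apply: upM Mzw; rewrite ?leIl ?leIr.
  - apply/asboolP/orP => [/primeM[]Mz|[]/asboolP].
    + by left; apply/asboolP.
    + by right; apply/asboolP.
    + exact/upM/leUl.
    + exact/upM/leUr.
  - by apply/asboolP => /My; rewrite meetx0 le0x.
  - exact/asboolP.
exists (BoolHom hom) => /=.
  apply/asboolP; apply: contrapT => /extend[a /GM Ma].
  by rewrite meetAC meetxx => /(My _ Ma).
by apply/asboolP => /My; rewrite leIr.
Qed.

Lemma bool_hom_inj (x y : L) : (forall p : bool_hom, p x = p y) -> x = y.
Proof.
move=> xy; apply/le_anti/andP; split; apply: contrapT => /prime_filter_separation.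
  by case=> p px; rewrite -xy px.
by case=> p py; rewrite xy py.
Qed.

Lemma bool_hom_compl (p : bool_hom) (x y : L) :
  x `&` y = \bot -> x `|` y = \top -> p x = ~~ p y.
Proof.
have [pI pU p0 p1] := bool_homP p.
by move=> /(congr1 p) + /(congr1 p); rewrite pI pU p0 p1; case: (p x); case: (p y).
Qed.

Section PairMap.
Variables u v : L -> L.
Hypothesis uv : forall x, u x <= v x.

Fact pair_map_subproof x :
  ((fun p : bool_hom => p (u x), fun p : bool_hom => p (v x))
     : (bool_hom -> bool) *p (bool_hom -> bool))
    \in @square_pred _ (bool_hom -> bool).
Proof.
apply/lefP => p /=; have [pI _ _ _] := bool_homP p.
by rewrite leEmeet -pI (meet_idPl (uv x)).
Qed.

(** Kept general in [u] and [v] to serve both signatures: the identity and double negation are used,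
    in the order that the inequality [uv] dictates. *)
Definition pair_map x : (bool_hom -> bool)^[2] := Square (pair_map_subproof x).

Lemma pair_map_morphism : tblattice_morphism u -> tblattice_morphism v ->
  tblattice_morphism pair_map.
Proof.
move=> [uI uU u0 u1] [vI vU v0 v1].
split=> [x y|x y||]; apply: val_inj; congr pair; apply/funext => p /=;
  have [pI pU p0 p1] := bool_homP p;
  by rewrite (uI, uU, u0, u1, vI, vU, v0, v1) (pI, pU, p0, p1).
Qed.

End PairMap.
End PrimeFilter.

(** * Negation in Stone algebras *)

Section StoneTheory.
Variables (d : Order.disp_t) (S : stoneType d).
Implicit Types x y : S.

Lemma le_simE x y : (y <= sim x) = (x `&` y == \bot).
Proof.
apply/idP/eqP => [yx|]; last exact: sim_max.
by apply/eqP; rewrite -lex0 -(meetx_sim x) leI2.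
Qed.

Lemma le_sim2 x : x <= sim (sim x).
Proof. by rewrite le_simE meetC meetx_sim. Qed.

Lemma le_sim x y : x <= y -> sim y <= sim x.
Proof. by move=> xy; rewrite le_simE -lex0 -(meetx_sim y) leI2. Qed.

Lemma sim3 x : sim (sim (sim x)) = sim x.
Proof. by apply/le_anti; rewrite le_sim2 le_sim// le_sim2. Qed.

Lemma simU x y : sim (x `|` y) = sim x `&` sim y.
Proof.
apply/le_anti; rewrite lexI !le_sim ?leUl ?leUr//= le_simE meetUl.
by rewrite meetA meetx_sim meet0x meetCA meetx_sim meetx0 joinxx.
Qed.

(** The Stone identity splits [c] into its meets with [sim y] and [sim (sim y)]; the first lies
    below [sim y], the second below [sim x]. *)
Lemma simI x y : sim (x `&` y) = sim x `|` sim y.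
Proof.
apply/le_anti; rewrite leUx !le_sim ?leIl ?leIr// !andbT.
set c := sim (x `&` y).
have cx : x `&` c <= sim y by rewrite le_simE meetA [y `&` x]meetC meetx_sim.
have cy : sim (sim y) `&` c <= sim x.
  by rewrite le_simE meetCA -lex0 -(meetx_sim (sim y)) [leRHS]meetC leI2.
rewrite -[c]meet1x -(joinsim_sim2 y) meetUl joinC leU2//.
exact: leIl.
Qed.

Lemma sim0 : sim \bot = \top :> S.
Proof. by apply/le_anti; rewrite lex1 le_simE meet0x eqxx. Qed.

Lemma sim1 : sim \top = \bot :> S.
Proof. by rewrite -(meetx_sim \top) meet1x. Qed.

Lemma sim2_morphism : tblattice_morphism (fun x => sim (sim x)).
Proof.
by split=> [x y|x y||]; rewrite !(simI, simU, sim0, sim1).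
Qed.

End StoneTheory.

(** * Dual Stone algebras, by order duality *)

Section DualStoneTheory.
Variables (d : Order.disp_t) (D : dualStoneType d).

(** On the order dual the axioms of [dneg] are literally those of [sim], so the facts about [sim]
    transfer. *)
#[local] HB.instance Definition _ := TBDistrLattice_isStone.Build _ D^d
  (@joinx_dneg d D) (@dneg_min d D) (@meetdneg_dneg2 d D).

Lemma dneg2_le (x : D) : dneg (dneg x) <= x.
Proof. exact: (@le_sim2 _ D^d). Qed.

Lemma dneg3 (x : D) : dneg (dneg (dneg x)) = dneg x.
Proof. exact: (@sim3 _ D^d). Qed.

Lemma dneg2_morphism : tblattice_morphism (fun x : D => dneg (dneg x)).
Proof. by have [I U b t] := @sim2_morphism _ D^d; split. Qed.

End DualStoneTheory.

(** * Representation by prime filters *)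

Lemma stone_representation d (S : stoneType d) :
  stone_embeddable S (bool_hom S -> bool)^[2].
Proof.
exists (pair_map (@le_sim2 d S)); split; last first.
  move=> x y /(congr1 (fun z => (square_val z).1)) xy.
  by apply: bool_hom_inj => p; exact: (congr1 (@^~ p) xy).
split; first by apply: pair_map_morphism; [split|exact: sim2_morphism].
(* In the target, negation complements the second coordinate, here [p (sim (sim x))]; [sim3] reduces
   both coordinates to this equation. *)
have compl p x : (p : bool_hom S) (sim x) = ~~ p (sim (sim x)).
  by apply: bool_hom_compl; rewrite ?meetx_sim ?joinsim_sim2.
move=> x; apply: val_inj; congr pair; apply/funext => p /=; rewrite ?sim3;
  exact: compl.
Qed.

Lemma dual_stone_representation d (D : dualStoneType d) :
  dual_stone_embeddable D (bool_hom D -> bool)^[2].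
Proof.
exists (pair_map (@dneg2_le d D)); split; last first.
  move=> x y /(congr1 (fun z => (square_val z).2)) xy.
  by apply: bool_hom_inj => p; exact: (congr1 (@^~ p) xy).
split; first by apply: pair_map_morphism; [exact: dneg2_morphism|split].
(* Now the first coordinate carries the double negation, and it is the one that [dneg]
   complements. *)
have compl p x : (p : bool_hom D) (dneg x) = ~~ p (dneg (dneg x)).
  by apply: bool_hom_compl; rewrite ?joinx_dneg ?meetdneg_dneg2.
move=> x; apply: val_inj; congr pair; apply/funext => p /=; rewrite ?dneg3;
  exact: compl.
Qed.

(** * Powers of the three-element chain *)

Section ThreePower.
Variable I : Type.

Fact three_pair_subproof (f : I -> three) :
  ((fun i => f i == \top, fun i => f i != \bot) : (I -> bool) *p (I -> bool))
    \in @square_pred _ (I -> bool).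
Proof. by apply/lefP => i /=; case: eqP => // ->. Qed.

Definition three_pair f : (I -> bool)^[2] := Square (three_pair_subproof f).

Definition pair_three (x : (I -> bool)^[2]) : I -> three := fun i =>
  if (square_val x).1 i then \top
  else if (square_val x).2 i then (inord 1 : 'I_3) else \bot.

Lemma threeP (P : three -> Prop) :
  P \bot -> P (inord 1 : 'I_3) -> P \top -> forall x, P x.
Proof.
move=> P0 P1 P2 [[|[|[|//]]] lt3].
- by rewrite (_ : Ordinal lt3 = \bot)//; exact: val_inj.
- by rewrite (_ : Ordinal lt3 = inord 1)//; apply: val_inj; rewrite /= inordK.
- by rewrite (_ : Ordinal lt3 = \top)//; exact: val_inj.
Qed.

Let mid_top : ((inord 1 : 'I_3) == \top :> three) = false.
Proof. by rewrite -val_eqE /= inordK. Qed.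
Let mid_bot : ((inord 1 : 'I_3) == \bot :> three) = false.
Proof. by rewrite -val_eqE /= inordK. Qed.

Lemma three_pair_bij : bijective three_pair.
Proof.
exists pair_three => [f|x].
  apply/funext => i; rewrite /pair_three /=.
  by elim/threeP: (f i); rewrite ?mid_top ?mid_bot.
(* The order between the coordinates rules out [(true, false)], which [pair_three] would send to
   [\top]. *)
apply: val_inj; have /lefP x12 := square_le12 x.
rewrite /= [RHS]surjective_pairing; congr pair; apply/funext => i;
  have := x12 i; rewrite /pair_three;
  by case: ((square_val x).1 i); case: ((square_val x).2 i);
    rewrite ?mid_top ?mid_bot.
Qed.

(** In a chain a meet is one of its arguments; this makes the second coordinate of [three_pair]
    preserve meets. *)
Lemma three_meet_neq0 (x y : three) :
  (x `&` y != \bot) = (x != \bot) && (y != \bot).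
Proof.
by elim/threeP: x; elim/threeP: y;
  rewrite ?(meet0x, meetx0, meet1x, meetx1, meetxx) ?eqxx ?mid_bot.
Qed.

Lemma three_join_eq1 (x y : three) :
  (x `|` y == \top) = (x == \top) || (y == \top).
Proof.
by elim/threeP: x; elim/threeP: y;
  rewrite ?(join0x, joinx0, join1x, joinx1, joinxx) ?eqxx ?mid_top.
Qed.

Lemma three_pair_morphism : tblattice_morphism three_pair.
Proof.
split=> [f g|f g||]; apply: val_inj; congr pair; apply/funext => i //=.
- exact: meet_eq1.
- exact: three_meet_neq0.
- exact: three_join_eq1.
- by rewrite join_eq0 negb_and.
Qed.

(** [three_sim] takes only the values [\bot] and [\top], on which the two coordinate tests agree. *)
Lemma three_pair_sim : {morph three_pair : f / sim f}.
Proof.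
move=> f; apply: val_inj; congr pair; apply/funext => i /=.
- by rewrite [LHS]/(three_sim (f i) == \top) /three_sim [RHS]/(~~ (f i != \bot));
    case: (f i == \bot).
- by rewrite [LHS]/(three_sim (f i) != \bot) /three_sim [RHS]/(~~ (f i != \bot));
    case: (f i == \bot).
Qed.

Lemma three_pair_dneg : {morph three_pair : f / dneg f}.
Proof.
move=> f; apply: val_inj; congr pair; apply/funext => i /=.
- by rewrite [LHS]/(three_dneg (f i) == \top) /three_dneg [RHS]/(~~ (f i == \top));
    case: (f i == \top).
- by rewrite [LHS]/(three_dneg (f i) != \bot) /three_dneg [RHS]/(~~ (f i == \top));
    case: (f i == \top).
Qed.

End ThreePower.

Theorem theorem4 :
  (forall I : Type, lattice_isomorphic (I -> three) (I -> bool)^[2])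
  /\ (forall I : Type,
        stone_isomorphic (I -> three) (I -> bool)^[2]
        /\ dual_stone_isomorphic (I -> three) (I -> bool)^[2])
  /\ (forall (d : Order.disp_t) (S : stoneType d),
        exists I : Type, stone_embeddable S (I -> bool)^[2])
  /\ (forall (d : Order.disp_t) (D : dualStoneType d),
        exists I : Type, dual_stone_embeddable D (I -> bool)^[2]).
Proof.
split=> [I|].
  by exists (@three_pair I); split;
    [exact: three_pair_morphism|exact: three_pair_bij].
split=> [I|].
  by split; exists (@three_pair I); (split; last exact: three_pair_bij);
    split; by [exact: three_pair_morphism|exact: three_pair_sim
              |exact: three_pair_dneg].
split=> d L; exists (bool_hom L).
  exact: stone_representation.
exact: dual_stone_representation.
Qed.
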